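(* Let $F$ be a field of characteristic not $2$ or $3$. Every polynomial identity satisfied by the iterated Leibniz bracket $\langle\langle a,b\rangle,c\rangle$ in every Leibniz algebra over $F$ is a consequence of the defining identities for Leibniz triple systems. That is, if $I(a_1,\dots,a_n)$ is a nonassociative polynomial over $F$ in indeterminates $a_1,\dots,a_n$ built from one trilinear operation $\langle -,-,-\rangle$ (an element of the free triple system on $a_1,\dots,a_n$), and $I$ vanishes under all substitutions in every Leibniz algebra over $F$ when the operation is interpreted as $\langle a,b,c\rangle=\langle\langle a,b\rangle,c\rangle$, then the image of $I$ in the free Leibniz triple system over $F$ on $a_1,\dots,a_n$ is zero (equivalently, $I$ is satisfied by every Leibniz triple system over $F$).
   Context: A (right) Leibniz algebra is a vector space $L$ with a bilinear map $(a,b)\mapsto\langle a,b\rangle$ satisfying $\langle\langle a,b\rangle,c\rangle=\langle\langle a,c\rangle,b\rangle+\langle a,\langle b,c\rangle\rangle$ for all $a,b,c\in L$. A Leibniz triple system is a vector space $T$ with a trilinear operation $\langle -,-,-\rangle\colon T\times T\times T\to T$ satisfying the following defining identities for all $a,b,c,d,e\in T$: $$\langle a,\langle b,c,d\rangle,e\rangle=\langle\langle a,b,c\rangle,d,e\rangle-\langle\langle a,c,b\rangle,d,e\rangle-\langle\langle a,d,b\rangle,c,e\rangle+\langle\langle a,d,c\rangle,b,e\rangle,$$ $$\langle a,b,\langle c,d,e\rangle\rangle=\langle\langle a,b,c\rangle,d,e\rangle-\langle\langle a,b,d\rangle,c,e\rangle-\langle\langle a,b,e\rangle,c,d\rangle+\langle\langle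 a,b,e\rangle,d,c\rangle.$$ A triple system here is a vector space with an arbitrary trilinear operation. *)

(* Defs.v *)
(* boolp serves only to decide membership in the ideal being factored out. *)
From HB Require Import structures.
From mathcomp Require Import all_boot all_order all_algebra.
From mathcomp Require Import finmap.
From mathcomp Require Import boolp.
From mathcomp Require Import monalg.

Set Implicit Arguments.
Unset Strict Implicit.
Unset Printing Implicit Defensive.

Import GRing.Theory.
Local Open Scope ring_scope.
Local Open Scope quotient_scope.

Section LeibnizStructures.
Variables (F : fieldType) (V : lmodType F).

Definition is_bilinear (br : V -> V -> V) : Prop :=
  (forall b, linear (fun a => br a b)) /\ (forall a, linear (br a)).

Definition is_trilinear (tr : V -> V -> V -> V) : Prop :=
  [/\ forall b c, linear (fun a => tr a b c),
      forall a c, linear (fun b => tr a b c)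
    & forall a b, linear (tr a b)].

Definition leibniz_algebra (br : V -> V -> V) : Prop :=
  is_bilinear br /\
  forall a b c, br (br a b) c = br (br a c) b + br a (br b c).

Definition iterated_bracket (br : V -> V -> V) (a b c : V) : V :=
  br (br a b) c.

Section LeibnizTripleSystem.
Variable tr : V -> V -> V -> V.

Definition lts_rhs1 (a b c d e : V) : V :=
  tr (tr a b c) d e - tr (tr a c b) d e
  - tr (tr a d b) c e + tr (tr a d c) b e.

Definition lts_rhs2 (a b c d e : V) : V :=
  tr (tr a b c) d e - tr (tr a b d) c e
  - tr (tr a b e) c d + tr (tr a b e) d c.

Definition leibniz_triple_system : Prop :=
  [/\ is_trilinear tr,
      forall a b c d e, tr a (tr b c d) e = lts_rhs1 a b c d e
    & forall a b c d e, tr a b (tr c d e) = lts_rhs2 a b c d e].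

End LeibnizTripleSystem.

End LeibnizStructures.

Lemma linear_fun0 (F : fieldType) (U V : lmodType F) (f : U -> V) :
  linear f -> f 0 = 0.
Proof.
by move=> lf; have := lf (-1) 0 0; rewrite scaler0 addr0 scaleN1r addNr.
Qed.

Lemma linear_funD (F : fieldType) (U V : lmodType F) (f : U -> V) :
  linear f -> forall u w, f (u + w) = f u + f w.
Proof. by move=> lf u w; rewrite -[u]scale1r lf !scale1r. Qed.

Lemma linear_funB (F : fieldType) (U V : lmodType F) (f : U -> V) :
  linear f -> forall u w, f (u - w) = f u - f w.
Proof.
by move=> lf u w; rewrite [u - w]addrC -[- w]scaleN1r lf scaleN1r addrC.
Qed.

Lemma lts_quotient (F : fieldType) (U V : lmodType F)
    (tU : U -> U -> U -> U) (tV : V -> V -> V -> V) (f : U -> V) :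
  linear f -> (forall x, exists p, x = f p) ->
  (forall p q r, f (tU p q r) = tV (f p) (f q) (f r)) ->
  is_trilinear tU ->
  (forall a b c d e, f (tU a (tU b c d) e) = f (lts_rhs1 tU a b c d e)) ->
  (forall a b c d e, f (tU a b (tU c d e)) = f (lts_rhs2 tU a b c d e)) ->
  leibniz_triple_system tV.
Proof.
move=> lf surj fM [l1 l2 l3] i1 i2.
have [fD fB] := (linear_funD lf, linear_funB lf).
split; first split.
- move=> y z c x x'; have [[p ->] [p' ->]] := (surj x, surj x').
  have [[q ->] [r ->]] := (surj y, surj z).
  by rewrite -lf -!fM l1 lf.
- move=> x z c y y'; have [[q ->] [q' ->]] := (surj y, surj y').
  have [[p ->] [r ->]] := (surj x, surj z).
  by rewrite -lf -!fM l2 lf.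
- move=> x y c z z'; have [[r ->] [r' ->]] := (surj z, surj z').
  have [[p ->] [q ->]] := (surj x, surj y).
  by rewrite -lf -!fM l3 lf.
- move=> a b c d e; have [[p ->] [q ->]] := (surj a, surj b).
  have [[r ->] [[s ->] [t ->]]] := (surj c, (surj d, surj e)).
  by rewrite /lts_rhs1 -!fM i1 fD !fB.
- move=> a b c d e; have [[p ->] [q ->]] := (surj a, surj b).
  have [[r ->] [[s ->] [t ->]]] := (surj c, (surj d, surj e)).
  by rewrite /lts_rhs2 -!fM i2 fD !fB.
Qed.

Lemma lts_relator_morph (F : fieldType) (U V : lmodType F)
    (tU : U -> U -> U -> U) (tV : V -> V -> V -> V) (f : U -> V) :
  linear f -> (forall p q r, f (tU p q r) = tV (f p) (f q) (f r)) ->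
  leibniz_triple_system tV ->
  (forall a b c d e, f (tU a (tU b c d) e - lts_rhs1 tU a b c d e) = 0) /\
  (forall a b c d e, f (tU a b (tU c d e) - lts_rhs2 tU a b c d e) = 0).
Proof.
move=> lf fM [_ i1 i2]; have [fD fB] := (linear_funD lf, linear_funB lf).
split=> a b c d e; rewrite !fB fD !fB !fM (i1, i2); exact: subrr.
Qed.

Inductive tmon (X : Type) : Type :=
| TVar of X
| TNode of tmon X & tmon X & tmon X.

Section TmonChoice.
Variable X : choiceType.

Fixpoint tmon_encode (t : tmon X) : GenTree.tree X :=
  match t with
  | TVar x => GenTree.Leaf x
  | TNode t1 t2 t3 =>
      GenTree.Node 0 [:: tmon_encode t1; tmon_encode t2; tmon_encode t3]
  end.

Fixpoint tmon_decode (t : GenTree.tree X) : option (tmon X) :=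
  match t with
  | GenTree.Leaf x => Some (TVar x)
  | GenTree.Node _ [:: t1; t2; t3] =>
      match tmon_decode t1, tmon_decode t2, tmon_decode t3 with
      | Some u1, Some u2, Some u3 => Some (TNode u1 u2 u3)
      | _, _, _ => None
      end
  | _ => None
  end.

Lemma tmon_encodeK : pcancel tmon_encode tmon_decode.
Proof. by elim=> [x|t1 IH1 t2 IH2 t3 IH3] //=; rewrite IH1 IH2 IH3. Qed.

HB.instance Definition _ := Choice.copy (tmon X) (pcan_type tmon_encodeK).

End TmonChoice.

Section LinearExtension.
Variables (F : fieldType) (K : choiceType) (V : lmodType F).

Definition mlin (f : K -> V) (p : {malg F[K]}) : V :=
  \sum_(k <- msupp p) p@_k *: f k.

Lemma mlinEw (f : K -> V) (p : {malg F[K]}) (D : {fset K}) :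
  fsubset (msupp p) D -> mlin f p = \sum_(k <- D) p@_k *: f k.
Proof.
move=> sD; rewrite /mlin (big_fset_incl _ sD) //= => k _ nk.
by rewrite mcoeff_outdom // scale0r.
Qed.

Lemma mlin_is_linear (f : K -> V) : linear (mlin f).
Proof.
move=> c p q; pose D := fsetU (msupp p) (msupp q).
rewrite (@mlinEw _ p D) ?fsubsetUl // (@mlinEw _ q D) ?fsubsetUr //.
rewrite (@mlinEw _ _ D); last first.
  apply: fsubset_trans (msuppD_le _ _) _.
  exact/fsetSU/msuppZ_le.
rewrite scaler_sumr -big_split /=; apply: eq_bigr => k _.
by rewrite mcoeffD mcoeffZ scalerDl scalerA.
Qed.

Lemma mlinU (f : K -> V) k : mlin f << k >> = f k.
Proof. by rewrite (mlinEw _ msuppU_le) big_seq_fset1 mcoeffUU scale1r. Qed.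

Lemma mlin_linear_fun (U : lmodType F) (f : U -> K -> V) (p : {malg F[K]}) :
  (forall k, linear (fun u => f u k)) -> linear (fun u => mlin (f u) p).
Proof.
move=> lf c u w; rewrite /mlin scaler_sumr -big_split /=.
apply: eq_bigr => k _.
by rewrite lf scalerDr !scalerA mulrC.
Qed.

End LinearExtension.

(* The free triple system on X, whose elements are the nonassociative
   polynomials in one trilinear operation with indeterminates in X. *)
Definition tpoly (F : fieldType) (X : choiceType) := {malg F[tmon X]}.
HB.instance Definition _ F X := GRing.Lmodule.on (tpoly F X).

Section FreeTripleSystem.
Variables (F : fieldType) (X : choiceType).
Local Notation P := (tpoly F X).

Definition tpoly_var (x : X) : P := << TVar x >>.

Definition tpoly_tri (p q r : P) : P :=
  mlin (fun t1 => mlin (fun t2 => mlin (fun t3 =>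
    << TNode t1 t2 t3 >> : P) r) q) p.

Lemma tpoly_tri_trilinear : is_trilinear tpoly_tri.
Proof.
split=> [q r|p r|p q]; first exact: mlin_is_linear.
- by apply: mlin_linear_fun => t1; apply: mlin_is_linear.
- apply: mlin_linear_fun => t1; apply: mlin_linear_fun => t2.
  exact: mlin_is_linear.
Qed.

Section Evaluation.
Variables (V : lmodType F) (tr : V -> V -> V -> V) (v : X -> V).

Fixpoint tmon_eval (t : tmon X) : V :=
  match t with
  | TVar x => v x
  | TNode t1 t2 t3 => tr (tmon_eval t1) (tmon_eval t2) (tmon_eval t3)
  end.

Definition tpoly_eval (p : P) : V := mlin tmon_eval p.

End Evaluation.

Definition satisfies (V : lmodType F) (tr : V -> V -> V -> V) (p : P) : Prop :=
  forall v : X -> V, tpoly_eval tr v p = 0.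

(* The ideal of the free triple system generated by all instances of the
   defining identities. *)
Inductive lts_ideal : P -> Prop :=
| lts_ideal0 : lts_ideal 0
| lts_idealL c p q : lts_ideal p -> lts_ideal q -> lts_ideal (c *: p + q)
| lts_ideal_rel1 a b c d e :
    lts_ideal (tpoly_tri a (tpoly_tri b c d) e - lts_rhs1 tpoly_tri a b c d e)
| lts_ideal_rel2 a b c d e :
    lts_ideal (tpoly_tri a b (tpoly_tri c d e) - lts_rhs2 tpoly_tri a b c d e)
| lts_ideal_tri1 p q r : lts_ideal p -> lts_ideal (tpoly_tri p q r)
| lts_ideal_tri2 p q r : lts_ideal q -> lts_ideal (tpoly_tri p q r)
| lts_ideal_tri3 p q r : lts_ideal r -> lts_ideal (tpoly_tri p q r).

Definition lts_pred : {pred P} := fun p => `[< lts_ideal p >].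

Lemma lts_predP p : reflect (lts_ideal p) (p \in lts_pred).
Proof. exact: asboolP. Qed.

Fact lts_pred_zmod : zmod_closed lts_pred.
Proof.
split; first exact/lts_predP/lts_ideal0.
move=> p q /lts_predP Ip /lts_predP Iq; apply/lts_predP.
by rewrite addrC -scaleN1r; apply: lts_idealL.
Qed.

HB.instance Definition _ := GRing.isZmodClosed.Build P lts_pred lts_pred_zmod.

Definition free_lts := Quotient.quot lts_pred.
HB.instance Definition _ := GRing.Zmodule.on free_lts.

Definition free_lts_proj (p : P) : free_lts := \pi_(Quotient.quot lts_pred) p.
Definition free_lts_repr (x : free_lts) : P := repr x.
Definition free_lts_scale (c : F) (x : free_lts) : free_lts :=
  free_lts_proj (c *: free_lts_repr x).
Definition free_lts_tri (x y z : free_lts) : free_lts :=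
  free_lts_proj
    (tpoly_tri (free_lts_repr x) (free_lts_repr y) (free_lts_repr z)).

Lemma free_lts_reprK x : free_lts_proj (free_lts_repr x) = x.
Proof. exact: reprK. Qed.

Lemma free_lts_projE p q :
  free_lts_proj p = free_lts_proj q <-> lts_ideal (p - q).
Proof.
split=> [/eqP h|h]; first by apply/lts_predP; rewrite Quotient.idealrBE.
by apply/eqP; rewrite /free_lts_proj -Quotient.idealrBE; apply/lts_predP.
Qed.

Lemma free_lts_proj_eq0 p : free_lts_proj p = 0 <-> lts_ideal p.
Proof.
have -> : 0 = free_lts_proj 0 by rewrite /free_lts_proj raddf0.
by rewrite free_lts_projE subr0.
Qed.

Lemma lts_idealB p q : lts_ideal p -> lts_ideal q -> lts_ideal (p - q).
Proof.
by move=> /lts_predP Ip /lts_predP Iq; apply/lts_predP; apply: rpredB.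
Qed.

Lemma lts_idealZ c p : lts_ideal p -> lts_ideal (c *: p).
Proof.
by move=> Ip; rewrite -[c *: p]addr0; apply: lts_idealL Ip lts_ideal0.
Qed.

Lemma free_lts_reprP p : lts_ideal (free_lts_repr (free_lts_proj p) - p).
Proof. by apply/free_lts_projE; rewrite free_lts_reprK. Qed.

Lemma free_lts_projD p q :
  free_lts_proj (p + q) = free_lts_proj p + free_lts_proj q.
Proof. exact: raddfD. Qed.

Lemma free_lts_projB p q :
  free_lts_proj (p - q) = free_lts_proj p - free_lts_proj q.
Proof. exact: raddfB. Qed.

Lemma free_lts_projZ c p :
  free_lts_proj (c *: p) = free_lts_scale c (free_lts_proj p).
Proof.
apply/esym/free_lts_projE; rewrite -scalerBr.
exact/lts_idealZ/free_lts_reprP.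
Qed.

Fact free_lts_scaleA c d x :
  free_lts_scale c (free_lts_scale d x) = free_lts_scale (c * d) x.
Proof. by rewrite -[x]free_lts_reprK -!free_lts_projZ scalerA. Qed.

Fact free_lts_scale1 : left_id 1 free_lts_scale.
Proof. by move=> x; rewrite -[x]free_lts_reprK -free_lts_projZ scale1r. Qed.

Fact free_lts_scaleDr : right_distributive free_lts_scale +%R.
Proof.
move=> c x y; rewrite -[x]free_lts_reprK -[y]free_lts_reprK.
by rewrite -free_lts_projD -!free_lts_projZ -free_lts_projD scalerDr.
Qed.

Fact free_lts_scaleDl x : {morph free_lts_scale^~ x : c d / c + d}.
Proof.
move=> c d; rewrite -[x]free_lts_reprK.
by rewrite -!free_lts_projZ -free_lts_projD scalerDl.
Qed.

HB.instance Definition _ := GRing.Zmodule_isLmodule.Build F free_lts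
  free_lts_scaleA free_lts_scale1 free_lts_scaleDr free_lts_scaleDl.

Lemma free_lts_proj_is_linear : linear free_lts_proj.
Proof. by move=> c p q; rewrite free_lts_projD free_lts_projZ. Qed.

HB.instance Definition _ :=
  GRing.isLinear.Build F P free_lts *:%R free_lts_proj free_lts_proj_is_linear.

Lemma free_lts_proj_tri p q r :
  free_lts_proj (tpoly_tri p q r)
  = free_lts_tri (free_lts_proj p) (free_lts_proj q) (free_lts_proj r).
Proof.
have [l1 l2 l3] := tpoly_tri_trilinear.
set p' := free_lts_repr (free_lts_proj p).
set q' := free_lts_repr (free_lts_proj q).
apply/esym; transitivity (free_lts_proj (tpoly_tri p' q' r)).
  apply/free_lts_projE; rewrite -(linear_funB (l3 _ _)).
  exact/lts_ideal_tri3/free_lts_reprP.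
transitivity (free_lts_proj (tpoly_tri p' q r)).
  apply/free_lts_projE; rewrite -(linear_funB (l2 _ _)).
  exact/lts_ideal_tri2/free_lts_reprP.
apply/free_lts_projE; rewrite -(linear_funB (l1 _ _)).
exact/lts_ideal_tri1/free_lts_reprP.
Qed.

Theorem free_lts_is_lts : leibniz_triple_system free_lts_tri.
Proof.
apply: (@lts_quotient F P free_lts tpoly_tri free_lts_tri free_lts_proj).
- exact: free_lts_proj_is_linear.
- by move=> x; exists (free_lts_repr x); rewrite free_lts_reprK.
- exact: free_lts_proj_tri.
- exact: tpoly_tri_trilinear.
- by move=> *; apply/free_lts_projE/lts_ideal_rel1.
- by move=> *; apply/free_lts_projE/lts_ideal_rel2.
Qed.

End FreeTripleSystem.

Section UniversalProperty.
Variables (F : fieldType) (X : choiceType) (V : lmodType F).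
Variables (tr : V -> V -> V -> V) (v : X -> V).
Local Notation P := (tpoly F X).
Local Notation ev := (@tpoly_eval F X V tr v).

Lemma malg_linear_ext (f g : P -> V) : linear f -> linear g ->
  (forall t, f << t >> = g << t >>) -> f =1 g.
Proof.
move=> lf lg fg p.
have lin (h : P -> V) : linear h ->
    h p = \sum_(t <- msupp p) p@_t *: h << t >>.
  move=> lh; have [h0 hD] := (linear_fun0 lh, linear_funD lh).
  have hZ c u : h (c *: u) = c *: h u by rewrite -[c *: u]addr0 lh h0 addr0.
  rewrite {1}[p]monalgE (big_morph h hD h0); apply: eq_bigr => t _.
  rewrite -hZ; congr h; apply/malgP=> k.
  by rewrite mcoeffZ !mcoeffU mulr_natr.
by rewrite (lin f lf) (lin g lg); apply: eq_bigr => t _; rewrite fg.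
Qed.

Lemma tpoly_eval_var x : ev (tpoly_var F x) = v x.
Proof. exact: mlinU. Qed.

Lemma tpoly_eval_tri : is_trilinear tr ->
  forall p q r, ev (tpoly_tri p q r) = tr (ev p) (ev q) (ev r).
Proof.
move=> [k1 k2 k3] p q r; have [l1 l2 l3] := @tpoly_tri_trilinear F X.
have le := mlin_is_linear (@tmon_eval F X V tr v).
apply: (@malg_linear_ext
  (fun p => ev (tpoly_tri p q r)) (fun p => tr (ev p) (ev q) (ev r))).
- by move=> c u w; rewrite l1 [ev _]le.
- by move=> c u w; rewrite [ev (_ + _)]le k1.
move=> t1; apply: (@malg_linear_ext
  (fun q => ev (tpoly_tri << t1 >> q r))
  (fun q => tr (ev << t1 >>) (ev q) (ev r))).
- by move=> c u w; rewrite l2 [ev _]le.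
- by move=> c u w; rewrite [ev (_ + _)]le k2.
move=> t2; apply: (@malg_linear_ext
  (fun r => ev (tpoly_tri << t1 >> << t2 >> r))
  (fun r => tr (ev << t1 >>) (ev << t2 >>) (ev r))).
- by move=> c u w; rewrite l3 [ev _]le.
- by move=> c u w; rewrite [ev (_ + _)]le k3.
by move=> t3; rewrite /tpoly_tri /tpoly_eval !mlinU.
Qed.

Theorem free_lts_universal : leibniz_triple_system tr ->
  exists f : free_lts F X -> V,
    [/\ linear f,
        forall x y z, f (free_lts_tri x y z) = tr (f x) (f y) (f z)
      & forall p, f (free_lts_proj p) = ev p].
Proof.
move=> [tl i1 i2]; have le := mlin_is_linear (@tmon_eval F X V tr v).
have evM := tpoly_eval_tri tl; have [k1 k2 k3] := tl.
have [r1 r2] := lts_relator_morph le evM (And3 tl i1 i2).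
have evI p : lts_ideal p -> ev p = 0.
  elim=> {p} [|c p q _ IHp _ IHq|||p q r _ IH|p q r _ IH|p q r _ IH].
  - exact: linear_fun0 le.
  - by rewrite (le c p q : ev _ = c *: ev p + ev q) IHp IHq scaler0 addr0.
  - exact: r1.
  - exact: r2.
  - by rewrite evM IH (linear_fun0 (k1 _ _)).
  - by rewrite evM IH (linear_fun0 (k2 _ _)).
  - by rewrite evM IH (linear_fun0 (k3 _ _)).
pose f x := ev (free_lts_repr x).
have fE p : f (free_lts_proj p) = ev p.
  apply/eqP; rewrite -subr_eq0 -(linear_funB le).
  exact/eqP/evI/free_lts_reprP.
exists f; split=> // [c x y|x y z].
  rewrite -[in LHS](free_lts_reprK x) -[in LHS](free_lts_reprK y) -free_lts_proj_is_linear fE.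
  exact: le.
by rewrite fE tpoly_eval_tri.
Qed.

End UniversalProperty.

(* Main.v *)
(* A Leibniz triple system T embeds into a Leibniz algebra T + E in such a way
   that its triple product is the iterated bracket; an identity of iterated
   brackets therefore holds in every Leibniz triple system, in particular in
   the free one.  In E, the bracket [a, b] of a, b in T is represented by the
   pair of its left action x |-> <a, b, x> and its right action
   x |-> <x, a, b> - <x, b, a>.  Rather than the span of these pairs, E is the
   larger space of the pairs (l, r) satisfying conditions that are linear,
   stable under the bracket, and sufficient for the Leibniz identity: above
   all, r is a derivation of T, and l + r has its values in the elements of T
   that annihilate T from the second and third positions, on which l
   vanishes. *)
Require Import Defs.
From HB Require Import structures.
From mathcomp Require Import all_boot all_order all_algebra.
From mathcomp Require Import boolp functions.
From mathcomp Require Import monalg.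
Set Implicit Arguments.
Unset Strict Implicit.
Unset Printing Implicit Defensive.

Import GRing.Theory.
Local Open Scope ring_scope.

(** * Linear maps and cancellation in abelian groups *)

Lemma linear_funN (F : fieldType) (U V : lmodType F) (f : U -> V) :
  linear f -> forall u, f (- u) = - f u.
Proof.
by move=> lf u; rewrite -[- u]add0r (linear_funB lf) (linear_fun0 lf) sub0r.
Qed.

Lemma linear_funZ (F : fieldType) (U V : lmodType F) (f : U -> V) :
  linear f -> forall c u, f (c *: u) = c *: f u.
Proof.
by move=> lf c u; rewrite -[c *: u]addr0 lf (linear_fun0 lf) addr0.
Qed.

(** A search step for the tactics below: the head [x] stays in place while [y] passes from the terms
    still to be examined to those already skipped. *)
Lemma addr_shift_eq0 (V : zmodType) (x y s t : V) :
  x + s + (y + t) = 0 -> x + (y + s) + t = 0.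
Proof. by rewrite -!addrA [in s + (y + t)]addrCA. Qed.

(* [abelian] decides identities of abelian groups by cancelling the head of a
   right-nested sum against its opposite.  The opposite is matched in the goal
   rather than built, so that its module instance is the one present there. *)
Ltac cancel_neg y :=
  match goal with
  | |- _ + (- y + _) + _ = 0 => idtac
  | |- _ + - y + _ = 0 => idtac
  | |- _ => apply: addr_shift_eq0; cancel_neg y
  end.

Ltac cancel_pos y :=
  match goal with
  | |- _ + (y + _) + _ = 0 => idtac
  | |- _ + y + _ = 0 => idtac
  | |- _ => apply: addr_shift_eq0; cancel_pos y
  end.

Ltac abelian_step :=
  rewrite -?addrA ?addr0 ?add0r;
  match goal with
  | |- - ?x + _ = 0 =>
      rewrite -[LHS]addr0; cancel_pos x; rewrite ?addKr ?addNr ?add0r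
  | |- ?x + _ = 0 =>
      rewrite -[LHS]addr0; cancel_neg x; rewrite ?addNKr ?subrr ?add0r
  end.

Ltac abelian :=
  apply/eqP; rewrite -subr_eq0; apply/eqP;
  rewrite ?(opprD, opprB, opprK, oppr0, addr0, add0r); repeat abelian_step;
  reflexivity.

(** * Pairs of left and right actions on a Leibniz triple system *)

Section OperatorPairs.
Variables (F : fieldType) (T : lmodType F) (tr : T -> T -> T -> T).

Definition inner_annihilator (z : T) : Prop :=
  forall x y, tr x z y = 0 /\ tr x y z = 0.

Definition tri_derivation (r : T -> T) : Prop :=
  forall a b c, r (tr a b c) = tr (r a) b c + tr a (r b) c + tr a b (r c).

(** The last condition is the second defining identity with [D.1] in place of [tr a b]. *)
Definition operator_pair (D : (T -> T) * (T -> T)) : Prop :=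
  [/\ linear D.1 /\ linear D.2,
      tri_derivation D.2,
      forall b, inner_annihilator (D.1 b + D.2 b),
      forall z, inner_annihilator z -> D.1 z = 0
    & forall b c x, D.1 (tr b c x) =
        tr (D.1 b) c x - tr (D.1 c) b x - tr (D.1 x) b c + tr (D.1 x) c b].

Definition inner_pair (a b : T) : (T -> T) * (T -> T) :=
  (tr a b, fun x => tr x a b - tr x b a).

(** Both components are dictated by the Leibniz identity: when [r] is right bracketing with G,
    [[D, G], x] = [[D, x], G] - [D, [x, G]] and [x, [D, G]] = [[x, D], G] - [[x, G], D]. *)
Definition pair_comm (r : T -> T) (D : (T -> T) * (T -> T)) :
    (T -> T) * (T -> T) :=
  (fun x => r (D.1 x) - D.1 (r x), fun x => r (D.2 x) - D.2 (r x)).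

Hypothesis ltsT : leibniz_triple_system tr.

Let tri_lin : is_trilinear tr. Proof. by case: ltsT. Qed.

Lemma triL b c : linear (fun a => tr a b c). Proof. by case: tri_lin. Qed.
Lemma triM a c : linear (fun b => tr a b c). Proof. by case: tri_lin. Qed.
Lemma triR a b : linear (tr a b). Proof. by case: tri_lin. Qed.

Lemma tri_addE :
  ((forall u w b c, tr (u + w) b c = tr u b c + tr w b c) *
   (forall u w a c, tr a (u + w) c = tr a u c + tr a w c) *
   (forall u w a b, tr a b (u + w) = tr a b u + tr a b w)) *
  ((forall u b c, tr (- u) b c = - tr u b c) *
   (forall u a c, tr a (- u) c = - tr a u c) *
   (forall u a b, tr a b (- u) = - tr a b u)).
Proof.
split; split; first split; try split; intros.
- exact: (linear_funD (triL _ _)).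
- exact: (linear_funD (triM _ _)).
- exact: (linear_funD (triR _ _)).
- exact: (linear_funN (triL _ _)).
- exact: (linear_funN (triM _ _)).
- exact: (linear_funN (triR _ _)).
Qed.

Lemma tri0E :
  (forall b c, tr 0 b c = 0) * (forall a c, tr a 0 c = 0) *
  (forall a b, tr a b 0 = 0).
Proof.
split; first split; intros.
- exact: (linear_fun0 (triL _ _)).
- exact: (linear_fun0 (triM _ _)).
- exact: (linear_fun0 (triR _ _)).
Qed.

Lemma tri_scaleE :
  (forall k u b c, tr (k *: u) b c = k *: tr u b c) *
  (forall k u a c, tr a (k *: u) c = k *: tr a u c) *
  (forall k u a b, tr a b (k *: u) = k *: tr a b u).
Proof.
split; first split; intros.
- exact: (linear_funZ (triL _ _)).
- exact: (linear_funZ (triM _ _)).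
- exact: (linear_funZ (triR _ _)).
Qed.

Lemma tri_midE a b c d e :
  tr a (tr b c d) e = tr (tr a b c) d e - tr (tr a c b) d e
                      - tr (tr a d b) c e + tr (tr a d c) b e.
Proof. by case: ltsT => _ ->. Qed.

Lemma tri_rightE a b c d e :
  tr a b (tr c d e) = tr (tr a b c) d e - tr (tr a b d) c e
                      - tr (tr a b e) c d + tr (tr a b e) d c.
Proof. by case: ltsT => _ _ ->. Qed.

(** Expansion by the two defining identities leaves only products nested in the first position, and
    these cancel formally. *)
Lemma inner_pairP a b : operator_pair (inner_pair a b).
Proof.
split=> /= [|x y z|z|z /(_ a b)[_ ->] //|x y z].
- split=> [c x y|c x y]; first exact: triR.
  by rewrite !triL scalerBr opprD addrACA.
- rewrite !tri_addE !tri_midE !tri_rightE; abelian.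
- by move=> x y; rewrite !tri_addE !tri_midE !tri_rightE; split; abelian.
- by rewrite tri_rightE.
Qed.

Lemma inner_annihilator_linear c z w :
  inner_annihilator z -> inner_annihilator w -> inner_annihilator (c *: z + w).
Proof.
move=> Iz Iw x y; have [z1 z2] := Iz x y; have [w1 w2] := Iw x y.
by rewrite triM triR z1 z2 w1 w2 scaler0 addr0.
Qed.

Lemma inner_annihilatorD u w : inner_annihilator (u + w) ->
  (forall x y, tr x u y = - tr x w y) * (forall x y, tr x y u = - tr x y w).
Proof.
move=> ann; split=> x y; have [/eqP e1 /eqP e2] := ann x y.
  by move: e1; rewrite tri_addE addr_eq0 => /eqP.
by move: e2; rewrite tri_addE addr_eq0 => /eqP.
Qed.

(** Since [D.1 z = 0], the element [D.2 z] equals [D.1 z + D.2 z]. *)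
Lemma derivation_inner_annihilator D z :
  operator_pair D -> inner_annihilator z -> inner_annihilator (D.2 z).
Proof.
by case=> _ _ ann kill _ Iz; move: (ann z); rewrite (kill z Iz) add0r.
Qed.

Lemma pair_commP D E :
  operator_pair D -> operator_pair E -> operator_pair (pair_comm D.2 E).
Proof.
move=> DP EP.
have [[_ linr] derr annD killD expD] := DP.
have [[linl' linr'] derr' annE killE expE] := EP.
have [rD rN] := (linear_funD linr, linear_funN linr).
have [l'D l'N] := (linear_funD linl', linear_funN linl').
have [r'D r'N] := (linear_funD linr', linear_funN linr').
split=> /= [|x y z|z|z Iz|x y z].
- by split=> c x y; rewrite !(linr, linl', linr') scalerBr opprD addrACA.
- rewrite derr derr' !(rD, r'D) !(derr, derr') !tri_addE; abelian.
(* The sum of the two commutators is the commutator of [D.2] with [E.1 + E.2]; both of its terms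
   annihilate, as [D.2] preserves annihilating elements. *)
- have -> : D.2 (E.1 z) - E.1 (D.2 z) + (D.2 (E.2 z) - E.2 (D.2 z)) =
            D.2 (E.1 z + E.2 z) - (E.1 (D.2 z) + E.2 (D.2 z)).
    by rewrite rD; abelian.
  have Iz := derivation_inner_annihilator DP (annE z).
  by rewrite -scaleN1r addrC; apply: inner_annihilator_linear.
- rewrite (killE _ Iz) (killE _ (derivation_inner_annihilator DP Iz)).
  by rewrite (linear_fun0 linr) subr0.
- rewrite derr expE !(rD, rN, l'D) !derr !expE !tri_addE; abelian.
Qed.

Lemma operator_pair_linear c D E :
  operator_pair D -> operator_pair E -> operator_pair (c *: D + E).
Proof.
case: D E => [l r] [l' r'] [[/= ll lr] der ann kill exp].
case=> [[/= ll' lr'] der' ann' kill' exp'].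
split=> /= [|x y z|z|z Iz|x y z]; rewrite ?fctE /=.
- split=> k x y; rewrite ?fctE.
    by rewrite ll ll' !scalerDr !scalerA mulrC addrACA.
  by rewrite lr lr' !scalerDr !scalerA mulrC addrACA.
- rewrite der der' !tri_addE !tri_scaleE !scalerDr; abelian.
- by rewrite addrACA -scalerDr; apply: inner_annihilator_linear.
- by rewrite (kill _ Iz) (kill' _ Iz) scaler0 addr0.
- rewrite exp exp' !tri_addE !tri_scaleE !(scalerDr, scalerN); abelian.
Qed.

Lemma operator_pair0 : operator_pair 0.
Proof.
change (operator_pair (fun=> 0, fun=> 0)).
split=> /= [|x y z|z x y|//|x y z].
- by split=> c x y; rewrite scaler0 addr0.
- by rewrite !tri0E !addr0.
- by rewrite !addr0 !tri0E.
- by rewrite !tri0E; abelian.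
Qed.

(* [ltsT] is kept as a dummy argument because the module structure on operator
   pairs depends on it. *)
Definition operator_pred of leibniz_triple_system tr :
  {pred (T -> T) * (T -> T)} := fun D => `[< operator_pair D >].

Lemma operator_predP D : reflect (operator_pair D) (D \in operator_pred ltsT).
Proof. exact: asboolP. Qed.

Lemma operator_pred_submod : submod_closed (operator_pred ltsT).
Proof.
split=> [|c D E /operator_predP DP /operator_predP EP]; apply/operator_predP.
  exact: operator_pair0.
exact: operator_pair_linear.
Qed.

End OperatorPairs.

HB.instance Definition _ (F : fieldType) (T : lmodType F)
    (tr : T -> T -> T -> T) (ltsT : leibniz_triple_system tr) :=
  GRing.isSubmodClosed.Build F ((T -> T) * (T -> T))%type (operator_pred ltsT)
    (operator_pred_submod ltsT).

(** * The enveloping Leibniz algebra *)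

Section EnvelopingAlgebra.
Variables (F : fieldType) (T : lmodType F) (tr : T -> T -> T -> T).
Hypothesis ltsT : leibniz_triple_system tr.

Record operators := Operators
  { operators_pair :> (T -> T) * (T -> T);
    _ : operators_pair \in operator_pred ltsT }.

HB.instance Definition _ := [isSub for operators_pair].
HB.instance Definition _ := [Choice of operators by <:].
HB.instance Definition _ := [SubChoice_isSubLmodule of operators by <:].

Lemma operatorsP (D : operators) : operator_pair tr D.
Proof. by apply/(operator_predP ltsT); case: D. Qed.

Definition mk_operators D (DP : operator_pair tr D) : operators :=
  Operators (introT (operator_predP ltsT D) DP).

Definition inner (a b : T) := mk_operators (inner_pairP ltsT a b).

Definition comm (E D : operators) :=
  mk_operators (pair_commP ltsT (operatorsP E) (operatorsP D)).

(* Bracketing on the right with (l', r') in E is the action of the derivation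
   r', on T as well as on E. *)
Definition env_bracket (x y : T * operators) : T * operators :=
  (x.2.1 y.1 + y.2.2 x.1, inner x.1 y.1 + comm y.2 x.2).

Lemma operatorsE (D E : operators) :
  D.1 =1 E.1 -> D.2 =1 E.2 -> D = E.
Proof.
move=> DE1 DE2; apply: val_inj.
rewrite /= [LHS]surjective_pairing [RHS]surjective_pairing.
by rewrite (funext DE1) (funext DE2).
Qed.

Let funE :=
  (fun (f g : T -> T) x => erefl : (f + g) x = f x + g x,
   fun c (f : T -> T) x => erefl : (c *: f) x = c *: f x,
   fun x => erefl : (0 : T -> T) x = 0).

Lemma operators_lin (D : operators) : linear D.1 /\ linear D.2.
Proof. by case: (operatorsP D). Qed.

Lemma env_bracket_bilinear : is_bilinear env_bracket.
Proof.
split=> [[b E]|[a D]] c [a1 D1] [a2 D2]; congr (_, _) => /=.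
- have [_ lE] := operators_lin E.
  by rewrite !funE lE scalerDr addrACA.
- have [l1 l2] := operators_lin E.
  apply: operatorsE => x; rewrite ?funE /= ?funE.
    rewrite (triL ltsT) (linear_funD l2) (linear_funZ l2).
    rewrite !scalerDr !scalerN; abelian.
  rewrite !(triM ltsT, triL ltsT, triR ltsT) (linear_funD l2) (linear_funZ l2).
  rewrite !scalerDr !scalerN; abelian.
- have [l1 l2] := operators_lin D.
  by rewrite !funE l1 scalerDr addrACA.
- have [l1 l2] := operators_lin D.
  apply: operatorsE => x; rewrite ?funE /= ?funE.
    rewrite (triM ltsT) (linear_funD l1) (linear_funZ l1).
    rewrite !scalerDr !scalerN; abelian.
  rewrite !(triM ltsT, triL ltsT, triR ltsT) (linear_funD l2) (linear_funZ l2).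
  rewrite !scalerDr !scalerN; abelian.
Qed.

Lemma env_bracket_leibniz : leibniz_algebra env_bracket.
Proof.
split=> [|[a D] [b E] [c G]]; first exact: env_bracket_bilinear.
have [[lD1 lD2] derD annD killD expD] := operatorsP D.
have [[_ lE2] derE annE _ _] := operatorsP E.
have [[_ lG2] derG _ _ _] := operatorsP G.
(* [E.1 z + E.2 z] annihilates, so [D.1] kills it. *)
have DE z : D.1 (E.1 z) = - D.1 (E.2 z).
  by apply/eqP; rewrite -addr_eq0 -(linear_funD lD1) (killD _ (annE z)).
(* For the same reason, [E.1 z] may be replaced by [- E.2 z] in the second and third positions of a
   product. *)
have trE1 z := inner_annihilatorD ltsT (annE z).
have trD1 z := inner_annihilatorD ltsT (annD z).
pose linE := ((linear_funD lD1, linear_funN lD1),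
  (linear_funD lD2, linear_funN lD2),
  (linear_funD lE2, linear_funN lE2), (linear_funD lG2, linear_funN lG2)).
congr (_, _); rewrite /= ?funE.
  rewrite /= !linE DE; abelian.
apply: operatorsE => x; rewrite ?funE /= ?funE /=.
  (* Left components: [D.1] meets the products in the right action of [inner b c], which [expD]
     expands. *)
  rewrite !linE !derE !derG !expD !(tri_addE ltsT) !trE1; abelian.
rewrite !linE !derE !derG !derD !(tri_addE ltsT) !trE1 !trD1; abelian.
Qed.

(** The first bracket is [inner a b] with zero component in [T], and its left action sends [c] to
    [tr a b c]. *)
Lemma iterated_env_bracket a b c :
  iterated_bracket env_bracket (a, 0) (b, 0) (c, 0) = (tr a b c, 0).
Proof.
rewrite /iterated_bracket; congr (_, _) => /=.
  by rewrite !funE subr0 !addr0.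
apply: operatorsE => x /=; rewrite ?funE /=;
  by rewrite !(funE, addr0, tri0E ltsT, subr0).
Qed.

Lemma env_eval (X : choiceType) (v : X -> T) (p : tpoly F X) :
  tpoly_eval (iterated_bracket env_bracket) (fun x => (v x, 0)) p =
  (tpoly_eval tr v p, 0).
Proof.
rewrite /tpoly_eval /mlin; elim/big_rec2: _ => [//|t y1 y2 _ ->].
suff -> : tmon_eval (iterated_bracket env_bracket) (fun x => (v x, 0)) t =
          (tmon_eval tr v t, 0).
  by congr (_, _) => /=; rewrite scaler0 addr0.
elim: t => [//|t1 IH1 t2 IH2 t3 IH3] /=.
by rewrite IH1 IH2 IH3 iterated_env_bracket.
Qed.

End EnvelopingAlgebra.

(** * Transfer of identities to all Leibniz triple systems *)

Lemma tpoly_eval_self (F : fieldType) (X : choiceType) (p : tpoly F X) :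
  tpoly_eval (@free_lts_tri F X) (fun x => free_lts_proj (tpoly_var F x)) p =
  free_lts_proj p.
Proof.
apply: (malg_linear_ext (mlin_is_linear _) (@free_lts_proj_is_linear F X)) p.
move=> t; rewrite mlinU; elim: t => [//|t1 IH1 t2 IH2 t3 IH3] /=.
by rewrite IH1 IH2 IH3 -free_lts_proj_tri /tpoly_tri !mlinU.
Qed.

Theorem theorem23 (F : fieldType)
    (hchar2 : 2%N \notin [pchar F]) (hchar3 : 3%N \notin [pchar F])
    (n : nat) (I : tpoly F 'I_n)
    (hI : forall (L : lmodType F) (br : L -> L -> L),
        leibniz_algebra br -> satisfies (iterated_bracket br) I) :
  free_lts_proj I = 0 /\
  (forall (T : lmodType F) (tr : T -> T -> T -> T),
      leibniz_triple_system tr -> satisfies tr I).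
Proof.
have lts_sat (T : lmodType F) (tr : T -> T -> T -> T) :
    leibniz_triple_system tr -> satisfies tr I.
  (* Substituting elements of [T] alone puts the value of [I] in [T], where it is the value for
     [tr]. *)
  move=> ltsT v; have := hI _ _ (env_bracket_leibniz ltsT) (fun x => (v x, 0)).
  by rewrite env_eval => -[].
(* The image of [I] is its value at the generators of the free Leibniz triple system, which is
   itself an instance of [lts_sat]. *)
split=> //; rewrite -tpoly_eval_self.
exact/lts_sat/free_lts_is_lts.
Qed.
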